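(* Let $n\ge1$, let $A$ and $\Sigma$ be real symmetric positive definite $n\times n$ matrices, and let $\mu\in\mathbb{R}^n$. Let $P$ be an orthogonal matrix with $P^T\Sigma^{1/2}A\Sigma^{1/2}P=\mathrm{diag}(\lambda_1,\dots,\lambda_n)$ and let $b=(b_1,\dots,b_n)^T=P^T\Sigma^{-1/2}\mu$. Define $$c_0=\exp\Big(-\tfrac12\sum_{i=1}^n b_i^2\Big)\prod_{i=1}^n(2\lambda_i)^{-1/2},\quad d_k=\tfrac12\sum_{i=1}^n(1-kb_i^2)(2\lambda_i)^{-k},\quad c_k=\frac1k\sum_{i=0}^{k-1}d_{k-i}c_i\quad(k\ge1).$$ Then both series $$\sum_{k=0}^\infty(-1)^kc_k\frac{y^{\frac n2+k-1}}{\Gamma\left(\frac n2+k\right)}\qquad\text{and}\qquad\sum_{k=0}^\infty(-1)^kc_k\frac{y^{\frac n2+k}}{\Gamma\left(\frac n2+k+1\right)}$$ converge uniformly in $y$ on every bounded interval of $y>0$.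
   Context: The two series are the series expansions of the probability density function and of the cumulative distribution function, respectively, of the quadratic form $\mathbf{x}^TA\mathbf{x}$ with $\mathbf{x}\sim\mathcal{N}(\mu,\Sigma)$. $\Sigma^{1/2}$ is the symmetric positive definite square root of $\Sigma$, and $\Gamma$ is the gamma function. Uniform convergence means uniform convergence of the sequence of partial sums. *)

(* Defs.v *)
From HB Require Import structures.
From mathcomp Require Import all_boot all_order all_algebra.
From mathcomp Require Import all_classical all_reals all_analysis.

Set Implicit Arguments.
Unset Strict Implicit.
Unset Printing Implicit Defensive.

Import Order.TTheory GRing.Theory Num.Theory.
Import numFieldNormedType.Exports.

Local Open Scope classical_set_scope.
Local Open Scope ring_scope.

Definition sym_posdef (R : realType) (n : nat) (M : 'M[R]_n) : Prop :=
  M^T = M /\ forall x : 'cV[R]_n, x != 0 -> 0 < (x^T *m M *m x) 0 0.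

(* Euler's integral; meaningful for 0 < x, where it is finite. *)
Definition Gamma (R : realType) (x : R) : R :=
  \int[lebesgue_measure]_(t in `]0%R, +oo[) (t `^ (x - 1) * expR (- t)).

Section coefficients.
Variables (R : realType) (n : nat) (lam : 'rV[R]_n) (b : 'cV[R]_n).

Definition coef_c0 : R :=
  expR (- (2^-1 * \sum_(i < n) b i 0 ^+ 2))
  * \prod_(i < n) (2 * lam 0 i) `^ (- 2^-1).

Definition coef_d (k : nat) : R :=
  2^-1 * \sum_(i < n) (1 - k%:R * b i 0 ^+ 2) * (2 * lam 0 i) ^- k.

(* The recursion for [c_k] refers to all earlier values, so the list
   [c_0; ...; c_k] is built; [coef_c_0] and [coef_c_rec] below are the
   intended defining equations. *)
Fixpoint coef_c_upto (k : nat) : seq R :=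
  if k is k'.+1 then
    let s := coef_c_upto k' in
    rcons s (k%:R^-1 * \sum_(0 <= i < k) coef_d (k - i) * s`_i)
  else [:: coef_c0].

Definition coef_c (k : nat) : R := (coef_c_upto k)`_k.

Lemma size_coef_c_upto k : size (coef_c_upto k) = k.+1.
Proof. by elim: k => //= k IH; rewrite size_rcons IH. Qed.

Lemma nth_coef_c_upto k i : (i <= k)%N -> (coef_c_upto k)`_i = coef_c i.
Proof.
elim: k => [|k IH]; first by rewrite leqn0 => /eqP ->.
rewrite leq_eqVlt => /orP[/eqP -> //|]; rewrite ltnS => ik.
by rewrite /= nth_rcons size_coef_c_upto ltnS ik IH.
Qed.

Lemma coef_c_0 : coef_c 0 = coef_c0.
Proof. by []. Qed.

Lemma coef_c_rec k : (0 < k)%N ->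
  coef_c k = k%:R^-1 * \sum_(0 <= i < k) coef_d (k - i) * coef_c i.
Proof.
case: k => // k _; rewrite {1}/coef_c /= nth_rcons size_coef_c_upto ltnn eqxx.
congr (_ * _); apply: eq_big_nat => i /andP[_ ik].
by rewrite nth_coef_c_upto.
Qed.

End coefficients.

(* Uniform convergence on I of the series with terms [u k], to some sum which
   does not depend on I, for every bounded interval I of positive reals. An
   interval may have 0 as an endpoint, and may be open, closed or half-open. *)
Definition series_cvg_unif_bounded_pos (R : realType) (u : nat -> R -> R) :=
  exists f : R -> R, forall I : set R,
    is_interval I -> bounded_set I -> I `<=` `]0, +oo[ ->
    {uniform I, (fun (N : nat) (y : R) => \sum_(0 <= k < N) u k y) @ \oo --> f}.

(* Main.v *)
Require Import Defs.
From HB Require Import structures.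
From mathcomp Require Import all_boot all_order all_algebra.
From mathcomp Require Import all_classical all_reals all_analysis.
From mathcomp Require Import measurable_realfun.
From mathcomp Require Import ring lra.
Import Order.TTheory GRing.Theory Num.Theory.
Import numFieldNormedType.Exports.
Local Open Scope classical_set_scope.
Local Open Scope ring_scope.

(** The recursion gives c_k = O(s^k) for some s. On the other hand
    Gamma(a + 1) >= M^(a + 1) e^(-2M) for every M > 0, so 1 / Gamma(n/2 + k)
    beats every geometric sequence, and the terms with k >= 1 are dominated by
    a geometric series uniformly in 0 < y <= B. In the first series with n = 1
    the term k = 0 is unbounded near 0, but a single term does not affect
    uniform convergence of the partial sums. *)

(** Once |d_k| <= D rho^k, strong induction gives the bound with s = rho (1 + D): the powers of rho
    in d_(k-i) c_i combine to rho^k, and the remaining sum of D (1 + D)^i telescopes. *)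
Lemma coef_c_bound (R : realType) (n : nat) (lam : 'rV[R]_n) (b : 'cV[R]_n) :
  exists C s : R, [/\ 0 <= C, 1 <= s & forall k, `|coef_c lam b k| <= C * s ^+ k].
Proof.
pose q : R := 1 + \sum_(i < n) `|(2 * lam 0 i)^-1|.
pose D : R := \sum_(i < n) (1 + b i 0 ^+ 2).
have D0 : 0 <= D by apply: sumr_ge0 => i _; rewrite addr_ge0 ?sqr_ge0.
have q1 : 1 <= q by rewrite lerDl sumr_ge0.
have q0 : 0 <= q by exact: le_trans q1.
have dq k : (0 < k)%N -> `|coef_d lam b k| <= D * (q *+ 2) ^+ k.
  move=> k0; rewrite /coef_d normrM ger0_norm// -[leRHS]mul1r.
  rewrite ler_pM// ?invf_le1 ?ler1n//.
  rewrite (le_trans (ler_norm_sum _ _ _))// mulr_suml ler_sum// => i _.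
  (* 2^k absorbs the factor k in 1 - k b_i^2, and q^k bounds (2 lam_i)^-k. *)
  have -> : (q *+ 2) ^+ k = 2 ^+ k * q ^+ k by rewrite -[q *+ 2]mulr_natl exprMn.
  rewrite normrM mulrA ler_pM//.
    rewrite (le_trans (ler_normB _ _))// normr1 normrM normr_nat (ger0_norm (sqr_ge0 _))//.
    have k2 : k%:R <= 2 ^+ k :> R by rewrite -natrX ler_nat ltnW// ltn_expl.
    have k1 : 1 <= 2 ^+ k :> R by rewrite exprn_ege1// ler1n.
    by have := sqr_ge0 (b i 0); nra.
  rewrite -exprVn normrX lerXn2r ?nnegrE//.
  by rewrite /q (bigD1 i)//= addrCA lerDl addr_ge0// sumr_ge0.
pose rho := q *+ 2.
have r1 : 1 <= rho by rewrite /rho; lra.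
have r0 : 0 <= rho by exact: le_trans r1.
have D1 : 0 <= 1 + D by rewrite addr_ge0.
exists `|coef_c lam b 0|, (rho * (1 + D)); split => //.
  by rewrite mulr_ege1// lerDl.
elim/ltn_ind => -[|k] IH; first by rewrite expr0 mulr1.
rewrite coef_c_rec// normrM -[leRHS]mul1r ler_pM//.
  by rewrite ger0_norm// invf_le1// ler1n.
rewrite (le_trans (ler_norm_sum _ _ _))//.
apply: (@le_trans _ _ (\sum_(0 <= i < k.+1)
    `|coef_c lam b 0| * rho ^+ k.+1 * (D * (1 + D) ^+ i))).
  rewrite !big_mkord ler_sum// => i _; rewrite normrM.
  have -> : `|coef_c lam b 0| * rho ^+ k.+1 * (D * (1 + D) ^+ i) =
     (D * rho ^+ (k.+1 - i)) * (`|coef_c lam b 0| * (rho * (1 + D)) ^+ i).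
    have -> : rho ^+ k.+1 = rho ^+ (k.+1 - i) * rho ^+ i.
      by rewrite -exprD subnK// ltnW.
    by rewrite exprMn; ring.
  by rewrite ler_pM// ?dq ?subn_gt0// IH.
rewrite -!mulr_sumr exprMn [leRHS]mulrA ler_wpM2l ?mulr_ge0 ?exprn_ge0//.
(* The sum of D (1 + D)^i over i <= k is (1 + D)^(k+1) - 1. *)
have := subrX1 (1 + D) k.+1; rewrite addrAC subrr add0r big_mkord => <-.
by rewrite gerBl.
Qed.

(** Raise t/c <= e^(t/c) to the power a; the choice c = 2(a + 1) makes a/c <= 1/2. *)
Lemma powR_le_expR (R : realType) (a : R) : 0 <= a ->
  exists K, forall t, 0 < t -> t `^ a <= K * expR (2^-1 * t).
Proof.
move=> a0; pose c := 2 * (a + 1); have c0 : 0 < c by rewrite /c; lra.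
exists (c `^ a) => t t0.
have tc0 : 0 <= t / c by rewrite divr_ge0// ltW.
rewrite -[t in leLHS](divfK (lt0r_neq0 c0)) mulrC powRM ?(ltW c0)//.
rewrite ler_wpM2l ?powR_ge0//.
apply: (@le_trans _ _ (expR (t / c) `^ a)).
  rewrite ge0_ler_powR ?nnegrE ?expR_ge0//.
  by rewrite (le_trans _ (expR_ge1Dx _))// lerDr.
rewrite -expRM ler_expR -subr_ge0.
have -> : 2^-1 * t - t / c * a = t / c.
  by rewrite /c; field; lra.
by [].
Qed.

(** By [powR_le_expR] the integrand is at most K e^(-t/2), which is 2K times the exponential density
    of rate 1/2. *)
Lemma Gamma_integrand_integrable (R : realType) (a : R) : 0 <= a ->
  lebesgue_measure.-integrable `]0, +oo[
    (EFin \o (fun t : R => t `^ a * expR (- t))).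
Proof.
move=> a0; have [K tK] := powR_le_expR _ _ a0.
have mf : measurable_fun [set: R] (fun t : R => t `^ a * expR (- t)).
  apply: measurable_funM; first exact: measurable_powR.
  by apply: measurableT_comp => //; exact: measurable_expR.
have iE : lebesgue_measure.-integrable [set: R] (EFin \o exponential_pdf (2^-1 : R)).
  apply/integrableP; split.
    by apply/measurable_EFinP; exact: measurable_exponential_pdf.
  under eq_integral => x _ do rewrite gee0_abs ?lee_fin ?exponential_pdf_ge0//.
  by rewrite integral_exponential_pdf// ltry.
have {}iE : lebesgue_measure.-integrable `]0, +oo[
    (EFin \o exponential_pdf (2^-1 : R)).
  exact: integrableS iE.
have {}iE : lebesgue_measure.-integrable `]0, +oo[
    (fun t => (K * 2)%:E * (exponential_pdf (2^-1 : R) t)%:E)%E.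
  exact: integrableZl iE.
apply: le_integrable iE => //.
  by apply/measurable_EFinP; exact: measurable_funTS.
move=> t /=; rewrite in_itv/= andbT => t0.
rewrite lee_fin ger0_norm ?mulr_ge0 ?powR_ge0 ?expR_ge0//.
rewrite (le_trans _ (ler_norm _))// exponential_pdfE ?(ltW t0)//.
rewrite mulrA mulfK// mulNr.
have -> : - t = - (2^-1 * t) - (2^-1 * t) by lra.
rewrite expRD mulrA ler_wpM2r ?expR_ge0//.
by rewrite expRN ler_pdivrMr ?expR_gt0// tK.
Qed.

(* On [M, 2M] the integrand of Gamma (a + 1) is at least M^a e^(-2M). *)
Lemma Gamma_ge (R : realType) (a M : R) : 0 <= a -> 0 < M ->
  M `^ a * expR (- (2 * M)) * M <= Gamma (a + 1).
Proof.
move=> a0 M0; rewrite /Gamma addrK.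
have iG := Gamma_integrand_integrable _ _ a0.
have sub : `[M, 2 * M] `<=` `]0, +oo[.
  by move=> t /=; rewrite !in_itv/= andbT => /andP[Mt _]; exact: lt_le_trans Mt.
have iG' : lebesgue_measure.-integrable `[M, 2 * M]
    (EFin \o (fun t : R => t `^ a * expR (- t))).
  by apply: integrableS iG.
have muI : fine (lebesgue_measure (`[M, 2 * M] : set R)) = M.
  by rewrite lebesgue_measure_itv/= lte_fin ifT -?EFinD/=; lra.
have Mf (t : R) : t \in `[M, 2 * M] ->
    M `^ a * expR (- (2 * M)) <= t `^ a * expR (- t).
  rewrite in_itv/= => /andP[Mt tM].
  by rewrite ler_pM ?powR_ge0 ?expR_ge0 ?ler_expR ?lerN2// ge0_ler_powR//
    nnegrE; lra.
apply: (@le_trans _ _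
    (\int[lebesgue_measure]_(t in `[M, 2 * M]) (t `^ a * expR (- t)))).
  apply: (@le_trans _ _
      (\int[lebesgue_measure]_(t in `[M, 2 * M]) (M `^ a * expR (- (2 * M))))).
    rewrite Rintegral_cst// -[X in X <= _]/(_ * M) ler_wpM2l ?mulr_ge0
      ?powR_ge0 ?expR_ge0//.
    by rewrite [leRHS]muI.
  apply: le_Rintegral => //.
  apply: le_integrable iG' => //; first exact: measurable_cst.
  move=> t /Mf; rewrite /= lee_fin !ger0_norm ?mulr_ge0 ?powR_ge0 ?expR_ge0//.
(* The real integral is [fine] of the extended one, so enlarging the domain is monotone only once
   both integrals are known to be finite. *)
rewrite /Rintegral fine_le ?integrable_fin_num//.
apply: ge0_subset_integral => //; first by case/integrableP : iG.
by move=> t _; rewrite lee_fin mulr_ge0 ?powR_ge0 ?expR_ge0.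
Qed.

(** Weierstrass M-test with the term k = 0 left free, as it may be unbounded near 0. The sum f is a
    pointwise limit, hence the same for all intervals. *)
Lemma series_cvg_unif_of_geometric (R : realType) (u : nat -> R -> R) :
  (forall B, 1 <= B -> exists K, forall k y, (0 < k)%N -> 0 < y <= B ->
     `|u k y| <= K * 2^-1 ^+ k) ->
  series_cvg_unif_bounded_pos u.
Proof.
move=> uB; have h1 : `|2^-1 : R| < 1 by rewrite ger0_norm// invf_lt1// ltr1n.
pose f y := limn (series (u ^~ y)).
have ucvg y : 0 < y -> series (u ^~ y) @ \oo --> f y.
  move=> y0; have [|K uK] := uB (Num.max 1 y); first by rewrite le_max lexx.
  have yK k : (0 < k)%N -> `|u k y| <= K * 2^-1 ^+ k.
    by move=> k0; rewrite uK// y0 le_max lexx orbT.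
  have K0 : 0 <= K.
    by have := le_trans (normr_ge0 _) (yK 1 isT); rewrite pmulr_lge0.
  apply: (@normed_cvg R R^o).
  (* For fixed y, adding |u_0(y)| to the constant makes the domination hold at k = 0 too. *)
  have := is_cvg_geometric_series (a := `|u 0 y| + K) h1.
  apply: series_le_cvg => [k|k|[|k]] /=; rewrite ?normr_ge0//.
  - by rewrite mulr_ge0 ?addr_ge0 ?exprn_ge0.
  - by rewrite expr0 mulr1 lerDl.
  - by rewrite (le_trans (yK _ _))// ler_wpM2r ?exprn_ge0// lerDr.
(* For N > 0 the term k = 0 cancels in the difference. The bound passes to the limit from the
   partial sums up to m; the factor 2 is the sum of 2^-j over j >= 0. *)
have tail B : 1 <= B -> exists K, forall N y, (0 < N)%N -> 0 < y <= B ->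
    `|f y - \sum_(0 <= k < N) u k y| <= K * 2^-1 ^+ N.
  move=> /uB[K uK]; exists (K * 2) => N y N0 yB.
  have K0 : 0 <= K.
    by have := le_trans (normr_ge0 _) (uK _ _ N0 yB); rewrite pmulr_lge0 ?exprn_gt0.
  have /andP[y0 _] := yB.
  have : `|series (u ^~ y) m - \sum_(0 <= k < N) u k y| @[m --> \oo]
      --> `|f y - \sum_(0 <= k < N) u k y|.
    by apply: cvg_norm; apply: cvgB; [exact: ucvg|exact: cvg_cst].
  move=> /cvgr_to_le; apply; near=> m.
  have Nm : (N <= m)%N by near: m; exact: nbhs_infty_ge.
  rewrite [X in `|X|](sub_series_geq (u ^~ y) Nm).
  rewrite (le_trans (ler_norm_sum _ _ _))//.
  apply: (@le_trans _ _ (\sum_(N <= k < m) K * 2^-1 ^+ k)).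
    by apply: ler_sum_nat => k /andP[Nk _]; rewrite uK// (leq_trans N0).
  rewrite -mulr_sumr -mulrA ler_wpM2l// -[m](subnKC Nm) geometric_partial_tail.
  rewrite (le_trans (geometric_le_lim _ _ _ _))// ?exprn_ge0//.
  by rewrite (_ : (1 - 2^-1)^-1 = 2 :> R) 1?mulrC//; field.
exists f => I _ bI Ipos P /uniform_nbhs [E [entE EP]].
move: entE; rewrite -entourage_ballE => -[e /= e0 eE].
(* [bounded_set] only provides bounds strictly above some M, hence M + 1. *)
have [B B1 IB] : exists2 B, 1 <= B & forall y, I y -> 0 < y <= B.
  case: bI => M [_ IM]; exists (Num.max 1 (M + 1)); first by rewrite le_max lexx.
  move=> y Iy; have := Ipos _ Iy; rewrite /= in_itv/= andbT => -> /=.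
  by rewrite le_max (le_trans (ler_norm y) (IM (M + 1) _ _ Iy)) ?ltrDl ?orbT.
have [K fK] := tail _ B1.
have /cvgrPdist_lt/(_ e e0) := cvg_geometric K h1.
apply: filter_app; near=> N => KN.
apply: EP => y Iy /=; apply: eE; rewrite /ball/=.
rewrite (le_lt_trans (fK N y _ (IB _ Iy)))//; first by near: N; exact: nbhs_infty_gt.
by rewrite (le_lt_trans _ KN)// sub0r normrN ler_norm.
Unshelve. all: by end_near. Qed.

(** Covers both series, with s = n/2 - 1 and s = n/2. The condition -1 <= s gives s + k >= 0 for k
    >= 1, as [Gamma_ge] requires. *)
Lemma series_coef_c_Gamma_cvg_unif (R : realType) (n : nat) (lam : 'rV[R]_n)
    (b : 'cV[R]_n) (s : R) : -1 <= s ->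
  series_cvg_unif_bounded_pos (fun (k : nat) (y : R) =>
    (-1) ^+ k * coef_c lam b k * (y `^ (s + k%:R) / Gamma (s + k%:R + 1))).
Proof.
move=> s1; have [C [r [C0 r1 cC]]] := coef_c_bound _ _ lam b.
apply: series_cvg_unif_of_geometric => B B1.
have r0 : 0 < r by exact: lt_le_trans r1.
have B0 : 0 < B by exact: lt_le_trans B1.
(* With M = 2rB the k-th term is O(r^k (B / M)^(s+k)) = O(2^-k). *)
pose M := 2 * r * B.
have M0 : 0 < M by rewrite !mulr_gt0.
exists (C * (2 * r) `^ (- s) * (expR (2 * M) / M)) => k y k0 /andP[y0 yB].
have sk0 : 0 <= s + k%:R.
  have k1 : 1 <= k%:R :> R by rewrite ler1n.
  by lra.
have G := Gamma_ge _ _ _ sk0 M0.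
have L0 : 0 < M `^ (s + k%:R) * expR (- (2 * M)) * M.
  by rewrite !mulr_gt0 ?powR_gt0 ?expR_gt0.
have G0 := lt_le_trans L0 G.
rewrite !normrM normrX normrN1 expr1n mul1r normfV (ger0_norm (powR_ge0 _ _)) (ger0_norm (ltW G0)).
apply: (@le_trans _ _ (C * r ^+ k *
    (B `^ (s + k%:R) / (M `^ (s + k%:R) * expR (- (2 * M)) * M)))).
  apply: ler_pM => //; first by rewrite divr_ge0 ?powR_ge0 ?ltW.
  apply: ler_pM; rewrite ?powR_ge0 ?invr_ge0 ?(ltW G0)//.
    by rewrite ge0_ler_powR// nnegrE ltW.
  by rewrite lef_pV2// posrE.
(* Both sides are equal: (B/M)^(s+k) = (2r)^-(s+k), and r^k cancels, leaving (2r)^-s 2^-k. *)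
rewrite le_eqVlt; apply/orP; left; apply/eqP.
rewrite [M `^ _]powRM ?mulr_ge0 ?ltW// (@powRD _ (2 * r)); last first.
  by rewrite mulf_neq0 ?implybT// gt_eqF.
rewrite powRN expRN powR_mulrn ?mulr_ge0 ?ltW// exprMn exprVn.
have := powR_gt0 (s + k%:R) B0; have := powR_gt0 s (mulr_gt0 (ltr0Sn R 1) r0).
move=> /lt0r_neq0 ? /lt0r_neq0 ?.
have ? : r ^+ k != 0 by rewrite expf_neq0// gt_eqF.
have ? : (2 : R) ^+ k != 0 by rewrite expf_neq0.
have ? : M != 0 by rewrite gt_eqF.
have ? : expR (2 * M) != 0 by rewrite gt_eqF ?expR_gt0.
by field; do ?[apply/andP; split].
Qed.

Theorem mainTheorem3 (R : realType) (n : nat) (hn : (1 <= n)%N)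
  (A Sigma : 'M[R]_n) (hA : sym_posdef A) (hSigma : sym_posdef Sigma)
  (mu : 'cV[R]_n)
  (* S is the symmetric positive definite square root of Sigma *)
  (S : 'M[R]_n) (hS : sym_posdef S) (hSS : S *m S = Sigma)
  (P : 'M[R]_n) (hP : P^T *m P = 1%:M)
  (lam : 'rV[R]_n) (hlam : P^T *m S *m A *m S *m P = diag_mx lam)
  (b : 'cV[R]_n) (hb : b = P^T *m invmx S *m mu) :
  series_cvg_unif_bounded_pos (fun (k : nat) (y : R) =>
    (-1) ^+ k * coef_c lam b k
    * (y `^ (n%:R / 2 + k%:R - 1) / Gamma (n%:R / 2 + k%:R))) /\
  series_cvg_unif_bounded_pos (fun (k : nat) (y : R) =>
    (-1) ^+ k * coef_c lam b k
    * (y `^ (n%:R / 2 + k%:R) / Gamma (n%:R / 2 + k%:R + 1))).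
Proof.
have n0 : 0 <= n%:R / 2 :> R by rewrite divr_ge0.
split; last by apply: series_coef_c_Gamma_cvg_unif; lra.
have -> : (fun (k : nat) (y : R) => (-1) ^+ k * coef_c lam b k
    * (y `^ (n%:R / 2 + k%:R - 1) / Gamma (n%:R / 2 + k%:R))) =
  (fun k y => (-1) ^+ k * coef_c lam b k
    * (y `^ (n%:R / 2 - 1 + k%:R) / Gamma (n%:R / 2 - 1 + k%:R + 1))).
  by apply/funext => k; apply/funext => y; rewrite [n%:R / 2 - 1 + _]addrAC subrK.
by apply: series_coef_c_Gamma_cvg_unif; lra.
Qed.
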